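(* Let $X$ be a connected compact (i.e. finite) network, let $u=u_0:X\to\mathbb{Z}_n$ be a continuous state on $X$, and let $u_t=\mathcal{G}^t(u)$ be its evolution under the Greenberg-Hastings model. Then the system eventually turns to the all-$0$ state (dies out) if and only if $u$ does not contain a defect.
   Context: A network is an undirected graph with node set $X$; $\mathcal{N}(x)$ is the set of neighbors of $x$. A state is a map $u:X\to\mathbb{Z}_n=\{0,1,\dots,n-1\}$, where $n$ is a fixed positive integer and arithmetic on states is modulo $n$. The Greenberg-Hastings update $\mathcal{G}$ is: $(\mathcal{G}u)(x)=u(x)+1$ (mod $n$) if $u(x)\ne 0$; $(\mathcal{G}u)(x)=1$ if $u(x)=0$ and $u(y)=1$ for some $y\in\mathcal{N}(x)$; $(\mathcal{G}u)(x)=0$ otherwise. A state $u$ is continuous on a subgraph if for every pair of neighbors $x,y$ in it, $|u(x)-u(y)|\le 1$, i.e. $u(x)-u(y)\in\{-1,0,1\}$ in $\mathbb{Z}_n$. A cycle is a formal linear combination $\alpha=\sum_{i=1}^K[a_i,b_i]$ of oriented edges of the network with boundary $\partial\alpha=\sum_{i=1}^K(b_i-a_i)=0$. If $u$ is continuous on $\alpha$, its degree on $\alpha$ is $\deg(u,\alpha)=\frac1n\sum_{i=1}^K(u(b_i)-u(a_i))$, where the summands are forced to be $-1$, $0$ or $1$ and the sum is ordinary addition (not mod $n$). A cycle $\alpha$ is a defect for $u$ if the degree of $u$ on $\alpha$ is nonzero; $u$ contains a defect if such a cycle exists. *)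

(* Defs.v *)
From HB Require Import structures.
From mathcomp Require Import all_boot all_order all_algebra.

Set Implicit Arguments.
Unset Strict Implicit.
Unset Printing Implicit Defensive.

Import Order.TTheory GRing.Theory Num.Theory.
Local Open Scope ring_scope.

(* The group of integers modulo n, for 0 < n. Unlike 'Z_n, this is still the
   right group when n = 1; its class of 1 is Zp1 (which is 0 when n = 1). *)
Notation Zmod n := 'I_n.-1.+1.

(* A network is a finite type of nodes with a symmetric neighbor relation. *)
Section GreenbergHastings.
Variables (X : finType) (n : nat).
Implicit Types (e : rel X) (u : X -> Zmod n) (alpha : seq (X * X)).

Definition GH e u : X -> Zmod n := fun x =>
  if u x != 0 then u x + Zp1
  else if [exists y, e x y && (u y == Zp1)] then Zp1
  else 0.

Definition dies_out e u : Prop :=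
  exists T : nat, forall t : nat, (T <= t)%N -> forall x, iter t (GH e) u x = 0.

Definition continuous_on e u : Prop :=
  forall x y, e x y -> u x - u y \in [:: - Zp1; 0; Zp1].

(* The list [:: (a_1, b_1); ...; (a_K, b_K)] stands for the chain
   [a_1, b_1] + ... + [a_K, b_K]; integer coefficients are encoded by repeating
   or reversing edges. The free abelian group on X is {ffun X -> int}. *)
Definition node (x : X) : {ffun X -> int} := [ffun y => (y == x)%:Z].

Definition boundary alpha : {ffun X -> int} :=
  \sum_(ab <- alpha) (node ab.2 - node ab.1).

Definition is_cycle e alpha : Prop :=
  {in alpha, forall ab, e ab.1 ab.2} /\ boundary alpha = 0.

(* The representative in {-1, 0, 1} of a class modulo n; the value on any other
   class is irrelevant. It is unique for n >= 3; when n = 2 the class of 1 = -1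
   is represented by 1, and when n = 1 the only class is represented by 0. *)
Definition small_rep (d : Zmod n) : int :=
  if d == 0 then 0 else if d == Zp1 then 1 else if d == - Zp1 then -1 else 0.

Definition deg u alpha : rat :=
  n%:R^-1 * (\sum_(ab <- alpha) small_rep (u ab.2 - u ab.1))%:~R.

Definition is_defect e u alpha : Prop :=
  [/\ is_cycle e alpha,
      continuous_on (fun a b => (a, b) \in alpha) u
    & deg u alpha != 0].

Definition contains_defect e u : Prop := exists alpha, is_defect e u alpha.

End GreenbergHastings.

(* Main.v *)
Require Import Defs.
From mathcomp Require Import all_boot all_order all_algebra.
From mathcomp Require Import zify.

Set Implicit Arguments.
Unset Strict Implicit.
Unset Printing Implicit Defensive.

Import Order.TTheory GRing.Theory Num.Theory.
Local Open Scope ring_scope.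

(** Suppose first that n >= 3. On an edge of the network the two values of a
continuous state differ by exactly one of the integers -1, 0, 1; this integer is
the rise of the state along the edge (rise). One step of the dynamics adds 1
to the state at the nodes that advance and 0 at the others, so it changes the
rise along (a, b), as an integer, by the difference of the two advances: the
only danger is that the gap grows to 2, and it does not, because a node
immediately behind a neighbor always advances (rise_GH_bound, rise_GH).

If the state dies out: the change of the total rise along a cycle is a sum of
differences of a function of the nodes, hence zero. The degree of a cycle is
thus invariant (deg_GH), and it vanishes in the all-0 state, so there is no
defect.

If there is no defect: the rises have total 0 along every cycle, so they are the
differences of an integer potential, obtained by adding rises along paths from a
base node (no_defect_potential). This lifts the state to an integer height
function, which the dynamics raises by 1 at each advancing node. Fix a multiple
of n above all the heights. A node at this multiple has value 0 and no neighbor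
higher up, so it never advances: the heights stay below it. The distances to it
(is_lag) are therefore natural numbers, and as long as some node has a nonzero
value that node advances, so the sum of the distances decreases. Hence the state
reaches 0 everywhere (lag_dies_out).

For n = 1 everything is 0. For n = 2 the rise is not antisymmetric: the classes
of 1 and -1 coincide, and an edge with two distinct values, traversed back and
forth, is a cycle of degree 1. In these cases both sides of the equivalence say
that the state takes equal values on neighbors: an edge with distinct values
keeps distinct values forever, whereas a locally constant state is 0 after one
step. *)

(** * Chains of edges and their boundaries *)

Section Chains.
Variable X : finType.
Implicit Types (e : rel X) (x : X) (p : seq X) (alpha : seq (X * X)).

(** A node function f extends to the linear form on the free abelian group that
    sends each node x to f x; both sides are its value on the boundary. *)
Lemma sum_boundary (f : X -> int) alpha :
  \sum_(ab <- alpha) (f ab.2 - f ab.1) = \sum_x f x * boundary alpha x.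
Proof.
have nodeE y : \sum_x f x * node y x = f y.
  rewrite (bigD1 y) //= ffunE eqxx mulr1 big1 ?addr0 // => x /negPf neq.
  by rewrite ffunE neq mulr0.
rewrite /boundary; elim: alpha => [|ab alpha IH].
  by rewrite !big_nil big1 // => x _; rewrite ffunE mulr0.
rewrite !big_cons IH -(nodeE ab.1) -(nodeE ab.2) -sumrB -big_split /=.
by apply: eq_bigr => x _; rewrite !ffunE mulrDr mulrBr.
Qed.

Definition edges x p := zip (x :: p) p.

Definition reverse_chain alpha := [seq (ab.2, ab.1) | ab <- alpha].

Lemma boundary_cat alpha beta :
  boundary (alpha ++ beta) = boundary alpha + boundary beta.
Proof. exact: big_cat. Qed.

Lemma boundary_reverse alpha : boundary (reverse_chain alpha) = - boundary alpha.
Proof.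
by rewrite /boundary big_map -sumrN; apply: eq_bigr => ab _; rewrite opprB.
Qed.

Lemma boundary_edges x p : boundary (edges x p) = node (last x p) - node x.
Proof.
rewrite /boundary; elim: p x => [|y p IH] x; first by rewrite big_nil subrr.
by rewrite big_cons IH addrC addrA subrK.
Qed.

Lemma edges_sub e x p : path e x p -> {in edges x p, forall ab, e ab.1 ab.2}.
Proof.
elim: p x => [|y p IH] x //= /andP [exy ep] ab.
by rewrite inE => /predU1P [-> //|]; apply: IH.
Qed.

End Chains.

(** * Rises along edges and advancing nodes *)

Section Dynamics.
Variables (X : finType) (n : nat) (e : rel X).
Implicit Types (u v : X -> Zmod n) (alpha : seq (X * X)).

Definition rise v (ab : X * X) : int := small_rep (v ab.2 - v ab.1).

Definition advances v x : bool :=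
  (v x != 0) || [exists y, e x y && (v y == Zp1)].

(** A resting node that gets excited goes from 0 to 1, so the update is always
    the addition of 0 or 1. *)
Lemma GH_advances v x : GH e v x = v x + Zp1 *+ advances v x.
Proof.
rewrite /GH /advances; have [->|//] := eqVneq (v x) 0.
by case: ifP => _ /=; rewrite ?add0r ?mulr0n.
Qed.

Hypothesis e_sym : symmetric e.

Lemma mulr1z_rise v : continuous_on e v ->
  forall a b, e a b -> v b - v a = Zp1 *~ rise v (a, b).
Proof.
move=> vc a b; rewrite e_sym => /vc; rewrite /rise /small_rep /= !inE.
have [->|_] := eqVneq (v b - v a) 0; first by rewrite mulr0z.
have [->|_ /=] := eqVneq (v b - v a) Zp1; first by rewrite mulr1z.
by rewrite orbF => /eqP ->; rewrite eqxx mulrN1z.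
Qed.

(** For n >= 3 the classes of -1, 0 and 1 are distinct, which is what makes the
    rise a faithful integer record of the difference of two neighbors. *)
Lemma small_rep_int (s : int) : (2 < n)%N -> `|s| <= 1 ->
  small_rep (Zp1 *~ s : Zmod n) = s.
Proof.
case: n => [|[|[|k]]] // _ s1.
have [->|[->|->]] : s = 0 \/ s = 1 \/ s = -1 by lia.
- by [].
- by [].
- by rewrite mulrN1z /small_rep oppr_eq0 [- _ == Zp1]eq_sym -addr_eq0 eqxx.
Qed.

Lemma GH_dead v : (forall x, v x = 0) -> forall x, GH e v x = 0.
Proof.
move=> v0 x; rewrite /GH v0 eqxx /=; case: ifP => // /existsP [y].
by rewrite v0 => /andP [_ /eqP].
Qed.

Lemma dead_dies_out v : (forall x, v x = 0) -> dies_out e v.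
Proof.
move=> v0; exists 0%N => t _; elim: t => [//|t IH] x.
by rewrite iterS GH_dead.
Qed.

Lemma dies_out_GH v : dies_out e (GH e v) -> dies_out e v.
Proof.
move=> [T dead]; exists T.+1 => -[//|t] tT.
by rewrite iterSr; apply: dead.
Qed.

(** * Invariance of the degree for n at least 3 *)

Section LargeModulus.
Hypothesis n_gt2 : (2 < n)%N.

Lemma rise_bound v ab : `|rise v ab| <= 1.
Proof. by rewrite /rise /small_rep; do 3!case: ifP => // _. Qed.

Lemma rise_swap v : continuous_on e v ->
  forall a b, e a b -> rise v (b, a) = - rise v (a, b).
Proof.
move=> vc a b eab; rewrite {1}/rise /= -opprB (mulr1z_rise vc eab) -mulrNz.
by rewrite small_rep_int // normrN rise_bound.
Qed.

(** The gap could only grow to 2 if the node ahead advanced and the node behind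
    did not. A node that does not advance has value 0, so if a neighbor is ahead
    of it that neighbor has value 1 and excites it. *)
Lemma rise_GH_bound v : continuous_on e v -> forall a b, e a b ->
  `|rise v (a, b) + (advances v b)%:Z - (advances v a)%:Z| <= 1.
Proof.
move=> vc a b eab; have := rise_bound v (a, b).
have ahead x y : e x y -> rise v (x, y) = 1 -> advances v x.
  move=> exy r1; rewrite /advances; case: eqVneq => //= x0.
  apply/existsP; exists y; rewrite exy /=.
  by have := mulr1z_rise vc exy; rewrite r1 x0 subr0 mulr1z => ->.
have eba : e b a by rewrite e_sym.
have := ahead _ _ eab; have := ahead _ _ eba; rewrite (rise_swap vc eab).
move: (rise _ _) => r; case: (advances v b); case: (advances v a) => /=; lia.
Qed.

Lemma GH_diff v : continuous_on e v -> forall a b, e a b ->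
  GH e v b - GH e v a
    = Zp1 *~ (rise v (a, b) + (advances v b)%:Z - (advances v a)%:Z).
Proof.
move=> vc a b eab; rewrite !GH_advances mulrzDr mulrzDr mulrNz.
by rewrite -(mulr1z_rise vc eab) -!pmulrn opprD addrACA addrA.
Qed.

Lemma rise_GH v : continuous_on e v -> forall a b, e a b ->
  rise (GH e v) (a, b)
    = rise v (a, b) + (advances v b)%:Z - (advances v a)%:Z.
Proof.
move=> vc a b eab; rewrite {1}/rise /= (GH_diff vc eab).
exact: small_rep_int (rise_GH_bound vc eab).
Qed.

Lemma continuous_GH v : continuous_on e v -> continuous_on e (GH e v).
Proof.
move=> vc a b eab; have eba : e b a by rewrite e_sym.
rewrite (GH_diff vc eba); have := rise_GH_bound vc eba.
move: (rise _ _ + _ - _) => s s1.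
have [->|[->|->]] : s = 0 \/ s = 1 \/ s = -1 by lia.
- by rewrite mulr0z !inE eqxx orbT.
- by rewrite mulr1z !inE eqxx !orbT.
- by rewrite mulrN1z !inE eqxx.
Qed.

(** The rises along the cycle change by differences of the advances at the two
    ends of its edges, and these differences cancel in a chain without
    boundary. *)
Lemma deg_GH v alpha : continuous_on e v -> is_cycle e alpha ->
  deg (GH e v) alpha = deg v alpha.
Proof.
move=> vc [alpha_e bd0]; rewrite /deg; congr (_ * _%:~R).
pose gain (ab : X * X) : int :=
  (advances v ab.2)%:Z - (advances v ab.1)%:Z.
have gain0 : \sum_(ab <- alpha) gain ab = 0.
  rewrite (sum_boundary (fun x => (advances v x)%:Z)) bd0.
  by rewrite big1 // => x _; rewrite ffunE mulr0.
transitivity (\sum_(ab <- alpha) (rise v ab + gain ab)); last first.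
  by rewrite big_split /= gain0 addr0.
apply: eq_big_seq => -[a b] /alpha_e eab.
by rewrite -[LHS]/(rise (GH e v) (a, b)) rise_GH //= addrA.
Qed.

Lemma dies_out_no_defect u : continuous_on e u ->
  dies_out e u -> ~ contains_defect e u.
Proof.
move=> uc [T dead] [alpha [cyc _ /eqP[]]].
have [_ <-] : continuous_on e (iter T (GH e) u)
    /\ deg (iter T (GH e) u) alpha = deg u alpha.
  elim: T {dead} => [//|T [vc <-]] /=.
  by split; [apply: continuous_GH | apply: deg_GH].
rewrite /deg big1 ?mulr0 // => ab _.
by rewrite !dead // subrr /small_rep eqxx.
Qed.

(** * Potentials force extinction for n at least 3 *)

(** g x is the distance from the height of x to a multiple of n that bounds all
    heights; measuring from above makes g decrease along the dynamics, and its
    values in nat record that the bound is never exceeded. *)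
Definition is_lag v (g : X -> nat) : Prop :=
  (forall x, v x = Zp1 *- g x) /\
  (forall a b, e a b -> rise v (a, b) = (g a)%:Z - (g b)%:Z).

(** A node of lag 0 has value 0 and, its neighbors having nonnegative lag too,
    none of them is ahead of it: nothing can excite it. *)
Lemma advances_le_lag v g : is_lag v g -> forall x, (advances v x <= g x)%N.
Proof.
move=> [vg eg] x; case: (boolP (advances v x)) => // /orP [].
  by rewrite vg; case: (g x) => //; rewrite mulr0n oppr0 eqxx.
case/existsP => y /andP [exy /eqP y1].
have [x0|] := eqVneq (v x) 0; last first.
  by rewrite vg; case: (g x) => //; rewrite mulr0n oppr0 eqxx.
have := eg _ _ exy; rewrite /rise /= y1 x0 subr0 -(mulr1z Zp1) small_rep_int //.
lia.
Qed.

Lemma lag_GH v g : continuous_on e v -> is_lag v g ->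
  is_lag (GH e v) (fun x => g x - advances v x)%N.
Proof.
move=> vc lag; have pos := advances_le_lag lag; case: (lag) => vg eg.
split=> [x|a b eab].
  by rewrite GH_advances vg mulrnBr // opprB addrC.
rewrite (rise_GH vc eab) eg //; have := pos a; have := pos b; lia.
Qed.

(** Every nonzero node advances, so the total lag strictly decreases until all
    values are 0. *)
Lemma lag_dies_out v g : continuous_on e v -> is_lag v g -> dies_out e v.
Proof.
have [m] := ubnP (\sum_x g x)%N.
elim: m => // m IH in v g * => sum_lt vc lag.
have [/forallP dead|] := boolP [forall x, v x == 0].
  by apply: dead_dies_out => x; apply/eqP.
rewrite negb_forall => /existsP [x x0]; apply: dies_out_GH.
apply: IH (continuous_GH vc) (lag_GH vc lag); move: sum_lt.
rewrite ltnS; apply: leq_trans.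
have pos := advances_le_lag lag; have := pos x.
rewrite [ltnLHS](bigD1 x) //= [ltnRHS](bigD1 x) //= {1 2}/advances x0 /= => gx.
rewrite -addSn leq_add //; first by rewrite -subSn // subn1.
by apply: leq_sum => y _; exact: leq_subr.
Qed.

(** * Potentials from the absence of defects *)

Definition total_rise v alpha : int := \sum_(ab <- alpha) rise v ab.

Lemma total_rise_cat v alpha beta :
  total_rise v (alpha ++ beta) = total_rise v alpha + total_rise v beta.
Proof. exact: big_cat. Qed.

Lemma total_rise_reverse v alpha : continuous_on e v ->
  {in alpha, forall ab, e ab.1 ab.2} ->
  total_rise v (reverse_chain alpha) = - total_rise v alpha.
Proof.
move=> vc alpha_e; rewrite /total_rise big_map -sumrN.
by apply: eq_big_seq => -[a b] /alpha_e; apply: rise_swap.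
Qed.

Lemma total_rise_path v x p : continuous_on e v -> path e x p ->
  v (last x p) = v x + Zp1 *~ total_rise v (edges x p).
Proof.
move=> vc; rewrite /total_rise; elim: p x => [|y p IH] x /=.
  by rewrite big_nil mulr0z addr0.
case/andP=> exy /IH ->; rewrite big_cons mulrzDr.
by rewrite -(mulr1z_rise vc exy) addrA [v x + _]addrC subrK.
Qed.

Lemma no_defect_total_rise u alpha : continuous_on e u ->
  ~ contains_defect e u -> is_cycle e alpha -> total_rise u alpha = 0.
Proof.
move=> uc nd cyc; apply/eqP/negPn/negP => tr0; apply: nd; exists alpha.
split=> //; first by move=> a b /(proj1 cyc); apply: uc.
by rewrite /deg mulf_neq0 ?intr_eq0 // invr_neq0 // pnatr_eq0; lia.
Qed.

(** Paths from x0 are chosen once and for all. For an edge from a to b, the path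
    to a, the edge, and the reversed path to b form a cycle, whose total rise is
    0 in the absence of defects. *)
Lemma no_defect_potential u (x0 : X) : continuous_on e u ->
  (forall x, connect e x0 x) -> ~ contains_defect e u ->
  exists h : X -> int, (forall x, u x = u x0 + Zp1 *~ h x) /\
    (forall a b, e a b -> rise u (a, b) = h b - h a).
Proof.
move=> uc conn nd.
have paths x : exists p, path e x0 p && (x == last x0 p).
  by have /connectP [p pp lp] := conn x; exists p; rewrite pp lp eqxx.
pose p x := xchoose (paths x).
have pP x : path e x0 (p x) by case/andP: (xchooseP (paths x)).
have pl x : last x0 (p x) = x by case/andP: (xchooseP (paths x)) => _ /eqP.
exists (fun x => total_rise u (edges x0 (p x))); split=> [x|a b eab].
  by rewrite -[in LHS](pl x) total_rise_path.
have eP x := edges_sub (pP x).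
pose alpha := edges x0 (p a) ++ [:: (a, b)] ++ reverse_chain (edges x0 (p b)).
have cyc : is_cycle e alpha.
  split=> [ab|].
    rewrite !mem_cat inE => /or3P [/eP //|/eqP -> //|/mapP [cd /eP ecd ->]].
    by rewrite /= e_sym.
  rewrite !boundary_cat boundary_reverse !boundary_edges !pl.
  rewrite {1}/boundary big_seq1 /= opprB addrA [node a - _ + _]addrC.
  by rewrite !addrA !subrK subrr.
have := no_defect_total_rise uc nd cyc.
rewrite !total_rise_cat total_rise_reverse // {2}/total_rise big_seq1; lia.
Qed.

Lemma no_defect_lag u : (forall x y : X, connect e x y) -> continuous_on e u ->
  ~ contains_defect e u -> exists g, is_lag u g.
Proof.
move=> conn uc nd; have [x0 _|noX] := pickP (fun _ : X => true); last first.
  by exists (fun=> 0%N); split=> [x|a]; [have := noX x | have := noX a].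
have [h [uh rh]] := no_defect_potential uc (conn x0) nd.
(* The multiple n * K of n dominates all the heights u x0 + h x. *)
pose K := (\sum_x `|h x| + n)%N.
pose lag x : int := (n * K)%:Z - (u x0 : nat)%:Z - h x.
have lag0 x : 0 <= lag x.
  have hK : (`|h x| + n <= K)%N by rewrite leq_add2r (bigD1 x) //= leq_addr.
  have uK : (u x0 < n)%N by have := ltn_ord (u x0); lia.
  have := leq_mul n_gt2 (leqnn K); rewrite /lag; lia.
have Zp1n : Zp1 *+ n = 0 :> Zmod n.
  apply: val_inj; rewrite Zp_mulrn /= modnMml mul1n.
  by case: n n_gt2 => // k; rewrite modnn.
have val_u : Zp1 *+ u x0 = u x0.
  by rewrite Zp_mulrn; apply: val_inj; rewrite /= modnMml mul1n modn_small.
have absE x : (`|lag x|%N)%:Z = lag x by rewrite gez0_abs.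
exists (fun x => `|lag x|%N); split=> [x|a b eab].
  rewrite uh pmulrn absE /lag !mulrzBr -!pmulrn mulrnA Zp1n mul0rn sub0r val_u.
  by rewrite opprB opprK addrC.
rewrite !absE rh // /lag; lia.
Qed.

End LargeModulus.

(** * The moduli 1 and 2 *)

Section SmallModulus.
Hypothesis n_le2 : (n <= 2)%N.

Lemma small_modulus_eq1 (d : Zmod n) : d != 0 -> d = Zp1.
Proof.
by case: n n_le2 d => [|[|[|k]]] // _ [[|[|m]] lm] // _; apply: val_inj.
Qed.

Lemma small_modulus_one2 : Zp1 + Zp1 = 0 :> Zmod n.
Proof. by case: n n_le2 => [|[|[|k]]] // _; apply: val_inj. Qed.

Definition locally_constant u := forall a b, e a b -> u a = u b.

(** If one end of an edge is 0 and the other is not, the latter is 1 and goes to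
    0 while it excites the former: the two values are exchanged. *)
Lemma dies_out_locally_constant u : dies_out e u -> locally_constant u.
Proof.
move=> [T dead] a b eab; apply/eqP; have := dead T (leqnn T).
have step v x y : e x y -> v x != v y -> GH e v x != GH e v y.
  wlog x0 : x y / v x = 0 => [hw exy vxy|exy].
    have [x0|x1] := eqVneq (v x) 0; first exact: hw.
    have [y0|y1] := eqVneq (v y) 0.
      by rewrite eq_sym hw // 1?eq_sym // e_sym.
    by move: vxy; rewrite (small_modulus_eq1 x1) (small_modulus_eq1 y1) eqxx.
  rewrite x0 eq_sym => y0; have y1 := small_modulus_eq1 y0.
  have fires : [exists z, e x z && (v z == Zp1)].
    by apply/existsP; exists y; rewrite exy y1 eqxx.
  by rewrite /GH x0 eqxx fires y0 y1 small_modulus_one2 -y1.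
move=> dT; apply/negPn/negP => neq.
suff: iter T (GH e) u a != iter T (GH e) u b by rewrite !dT eqxx.
by elim: T {dead dT} => [//|T IH]; apply: step.
Qed.

(** A nonzero value becomes 1 + 1 = 0, and a node at 0 has no neighbor to excite
    it unless n = 1, when 1 = 0. *)
Lemma locally_constant_dies_out u : locally_constant u -> dies_out e u.
Proof.
move=> lc; apply: dies_out_GH; apply: dead_dies_out => x; rewrite /GH.
case: eqVneq => [x0|/small_modulus_eq1 -> /=]; last exact: small_modulus_one2.
by case: ifP => //= /existsP [y /andP [/lc <- /eqP <-]].
Qed.

Lemma locally_constant_no_defect u : locally_constant u -> ~ contains_defect e u.
Proof.
move=> lc [alpha [[alpha_e _] _ /eqP []]].
rewrite /deg big1_seq ?mulr0 // => ab /= /alpha_e /lc ->.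
by rewrite subrr /small_rep eqxx.
Qed.

(** An edge whose ends differ, traversed forth and back, contributes 1 both
    times since 1 and -1 have the same representative, so it is a defect. *)
Lemma no_defect_locally_constant u : continuous_on e u ->
  ~ contains_defect e u -> locally_constant u.
Proof.
move=> uc nd a b eab; apply/eqP/negPn/negP => neq; apply: nd.
have eba : e b a by rewrite e_sym.
exists [:: (a, b); (b, a)]; split.
- split=> [ab|].
    by rewrite !inE => /orP [] /eqP ->.
  by rewrite /boundary !big_cons big_nil /= addr0 addrA subrK subrr.
- by move=> x y xy; apply: uc; move: xy; rewrite !inE => /orP [] /eqP [-> ->].
- have n0 : (n != 0)%N.
    by move: neq; case: (n) (u) => // v; rewrite (ord1 (v a)) (ord1 (v b)).
  have rise1 x y : u x != u y -> small_rep (u y - u x) = 1.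
    move=> xy; have d0 : u y - u x != 0 by rewrite subr_eq0 eq_sym.
    by rewrite /small_rep (negPf d0) -{1}(small_modulus_eq1 d0) eqxx.
  have neq' : u b != u a by rewrite eq_sym.
  rewrite /deg !big_cons big_nil /= (rise1 _ _ neq) (rise1 _ _ neq').
  by rewrite mulf_neq0 // invr_eq0 pnatr_eq0.
Qed.

End SmallModulus.
End Dynamics.

Theorem theorem1 (n : nat) (n_gt0 : (0 < n)%N)
    (X : finType) (e : rel X) (e_sym : symmetric e)
    (e_conn : forall x y : X, connect e x y)
    (u : X -> Zmod n) (u_cont : continuous_on e u) :
  dies_out e u <-> ~ contains_defect e u.
Proof.
have [n_le2|n_gt2] := leqP n 2.
  split=> [/(dies_out_locally_constant e_sym n_le2)|nd].
    exact: locally_constant_no_defect.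
  apply: locally_constant_dies_out => //.
  exact: no_defect_locally_constant.
split=> [|nd]; first exact: dies_out_no_defect.
have [g lag] := no_defect_lag e_sym n_gt2 e_conn u_cont nd.
exact: lag_dies_out lag.
Qed.
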